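(* \[ \sum_{i,j\ge1}t(i+1,\{1\}_{j-1})x^iy^j=\frac{xy}{1-x}\,{}_3F_2\!\left(\frac12+\frac y2,\ \frac12-\frac x2,\ 1;\ \frac32,\ \frac32-\frac x2;\ 1\right). \]
   Context: $t(i_1,\dots,i_k)=\sum_{n_1>\cdots>n_k\ge1,\ n_j\text{ odd}}n_1^{-i_1}\cdots n_k^{-i_k}$ for $i_1\ge2$; $\{1\}_{j-1}$ denotes $1$ repeated $j-1$ times (so for $j=1$ the term is $t(i+1)$). ${}_3F_2(a_1,a_2,a_3;b_1,b_2;z)=\sum_{s\ge0}\frac{(a_1)_s(a_2)_s(a_3)_s}{(b_1)_s(b_2)_s}\frac{z^s}{s!}$ with $(a)_s=a(a+1)\cdots(a+s-1)$ the generalized hypergeometric function. *)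

(* Defs.v *)
From HB Require Import structures.
From mathcomp Require Import all_boot all_order all_algebra finmap complex.
From mathcomp Require Import all_classical all_reals all_analysis.
From mathcomp Require summability.

Set Implicit Arguments.
Unset Strict Implicit.
Unset Printing Implicit Defensive.
Import Order.TTheory GRing.Theory Num.Theory.
Import numFieldNormedType.Exports.
Local Open Scope classical_set_scope.
Local Open Scope ring_scope.

(* The summation indices n_1 > ... > n_k >= 1, all odd; n_j >= 1 holds because
   0 is not odd. *)
Definition odd_chains (k : nat) : set (seq nat) :=
  [set ns | [/\ size ns = k, sorted gtn ns & all odd ns]].

(* t(i_1, ..., i_k) for s = [:: i_1; ...; i_k]. The terms are nonnegative, so
   esum is the value of the series in [0, +oo]; it is finite when i_1 >= 2, and
   the junk value 0 given by fine in the divergent case is then never used. *)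
Definition multiple_t (R : realType) (s : seq nat) : R :=
  fine (\esum_(ns in odd_chains (size s))
          (\prod_(ni <- zip ns s) ni.1%:R ^- ni.2)%:E).

Definition rising_factorial (K : pzRingType) (a : K) (s : nat) : K :=
  \prod_(k < s) (a + k%:R).

Definition hyp3F2_term (K : numFieldType) (a1 a2 a3 b1 b2 z : K) (s : nat)
    : K^o :=
  rising_factorial a1 s * rising_factorial a2 s * rising_factorial a3 s
    / (rising_factorial b1 s * rising_factorial b2 s) * (z ^+ s / s`!%:R).

(* Meaningful only where the series converges. *)
Definition hyp3F2 (K : numFieldType) (a1 a2 a3 b1 b2 z : K) : K^o :=
  limn (series (hyp3F2_term a1 a2 a3 b1 b2 z)).

(* R[i]^o is R[i] with the topology of its norm. *)
Definition t_gen_term (R : realType) (x y : R[i]) (i j : nat) : R[i]^o :=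
  (multiple_t R (i.+1 :: nseq j.-1 1%N))%:C%C * x ^+ i * y ^+ j.

(* Unconditional convergence of \sum_(i, j >= 1) u i j to l: the sums over
   finite sets of index pairs converge along inclusion. The pair (m, n)
   stands for (i, j) = (m + 1, n + 1). *)
Definition double_sum_to (K : numFieldType) (u : nat -> nat -> K^o) (l : K^o)
    : Prop :=
  summability.partial_sum (fun p : nat * nat => u p.1.+1 p.2.+1)
    @ summability.totally --> l.

(* Main.v *)
(* Group the multiple sums by their largest index 2 s + 1. With
   c_j = 1 / (2 j + 1), the sum over the smaller indices is the elementary
   symmetric polynomial e_(j-1)(c_0, ..., c_(s-1)), so summing over j gives the
   product \prod_(k < s) (1 + c_k y), while the sum over i is geometric. Hence
   the generating function is
     x y \sum_s c_s^2 \prod_(k < s) (1 + c_k y) / (1 - c_s x),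
   which is the hypergeometric series term by term. Exchanging the summations is
   legitimate because the same series with |x|, |y| converges: it is dominated
   by a telescoping series when |y| < 2. *)

Require Import Defs.
From HB Require Import structures.
From mathcomp Require Import all_boot all_order all_algebra finmap complex.
From mathcomp Require Import all_classical all_reals all_analysis.
From mathcomp Require Import ring lra.

Set Implicit Arguments.
Unset Strict Implicit.
Unset Printing Implicit Defensive.
Import Order.TTheory GRing.Theory Num.Theory.
Import numFieldNormedType.Exports.
Local Open Scope classical_set_scope.
Local Open Scope ring_scope.

(** * Finite index sets and the building blocks of the double series *)

Lemma big_fset_sub_split (I : choiceType) (V : nmodType) (J J' : {fset I})
    (f : I -> V) : (J `<=` J')%fset ->
  \sum_(p <- J') f p = \sum_(p <- J) f p + \sum_(p <- J' | p \notin J) f p.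
Proof.
move=> JJ'; rewrite (bigID (fun p => p \in J)) /=; congr (_ + _).
rewrite -big_filter; apply: perm_big; apply: uniq_perm.
- by rewrite filter_uniq// fset_uniq.
- exact: fset_uniq.
by move=> p; rewrite mem_filter andb_idr// => /(fsubsetP JJ').
Qed.

Definition odd_inv (K : numFieldType) (j : nat) : K := (j.*2.+1)%:R^-1.

(* The elementary symmetric polynomial of degree [k] in the first [s] values
   [1, 1/3, ..., 1 / (2 s - 1)] of [odd_inv]. *)
Fixpoint odd_esym (K : numFieldType) (k s : nat) : K :=
  if k is k'.+1 then \sum_(j < s) odd_inv K j * odd_esym K k' j else 1.

Definition odd_prod (K : numFieldType) (y : K) (s : nat) : K :=
  \prod_(j < s) (1 + odd_inv K j * y).

(* The part of [t(m + 2, {1}_n) x^m y^n], [p = (m, n)], whose largest index is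
   [2 s + 1]. *)
Definition t_summand (K : numFieldType) (x y : K) (s : nat) (p : nat * nat)
    : K :=
  odd_inv K s ^+ p.1.+2 * odd_esym K p.2 s * (x ^+ p.1 * y ^+ p.2).

(* The closed form of the sum of [t_summand x y s p] over all [p]. *)
Definition t_slice (K : numFieldType) (x y : K) (s : nat) : K :=
  odd_inv K s ^+ 2 * odd_prod y s / (1 - odd_inv K s * x).

(** Squares are cofinal among the finite index sets, and a sum of [t_summand] over a square factors
    into a sum over [m] and a sum over [n]. *)
Definition square_fset (N : nat) : {fset nat * nat} :=
  seq_fset tt [seq (m, n) | m <- iota 0 N, n <- iota 0 N].

Lemma in_square_fset (N : nat) (p : nat * nat) :
  (p \in square_fset N) = (p.1 < N)%N && (p.2 < N)%N.
Proof.
rewrite seq_fsetE; apply/allpairsP/andP.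
  by case=> -[m n] /=; rewrite !mem_iota /= !add0n => -[? ? ->].
by case: p => m n /= [mN nN]; exists (m, n); rewrite !mem_iota.
Qed.

Lemma fset_sub_square (A : {fset nat * nat}) :
  exists N, forall N', (N <= N')%N -> (A `<=` square_fset N')%fset.
Proof.
exists (\max_(p <- A) maxn p.1 p.2).+1 => N' NN'.
apply/fsubsetP => p pA; rewrite in_square_fset -gtn_max.
apply: leq_ltn_trans NN'.
by apply: (@leq_bigmax_seq _ _ xpredT (fun p => maxn p.1 p.2)).
Qed.

(** * Closed form, remainder and norm bounds for one slice *)

Section NumField.
Variable K : numFieldType.
Implicit Types (x y : K) (j k m n s N : nat).

Lemma odd_inv_gt0 j : 0 < odd_inv K j.
Proof. by rewrite invr_gt0 ltr0n. Qed.

Lemma odd_inv_le1 j : odd_inv K j <= 1.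
Proof. by rewrite invf_le1 ?ltr0n// ler1n. Qed.

Lemma odd_esym_ge0 k s : 0 <= odd_esym K k s.
Proof.
elim: k s => [|k IH] s /=; first exact: ler01.
by apply: sumr_ge0 => j _; rewrite mulr_ge0 ?IH// ltW ?odd_inv_gt0.
Qed.

Lemma odd_prodS y s :
  odd_prod y s.+1 = odd_prod y s * (1 + odd_inv K s * y).
Proof. by rewrite /odd_prod big_ord_recr. Qed.

(** Generating function of the elementary symmetric polynomials. The truncation at [N > s] loses
    nothing, since $e_n$ of $s$ values vanishes for $n > s$. The induction rests on $e_{n+1}(s+1) =
    e_{n+1}(s) + c_s e_n(s)$. *)
Lemma sum_odd_esym y s N : (s < N)%N ->
  \sum_(n < N) odd_esym K n s * y ^+ n = odd_prod y s.
Proof.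
elim: s N => [|s IH] [//|N] sN.
  rewrite /odd_prod big_ord0 big_ord_recl /= mulr1 big1 ?addr0// => i _.
  by rewrite big_ord0 mul0r.
rewrite odd_prodS mulrDr mulr1.
(* The copy to be multiplied by $c_s y$ is truncated one degree earlier, so that both copies end at
   the same degree after the shift. *)
rewrite -{1}(IH N.+1) ?(ltnW sN)// -(IH N)// !big_ord_recl /= -addrA.
congr (_ + _); rewrite mulr_suml -big_split; apply: eq_bigr => i _ /=.
by rewrite big_ord_recr /= add0n exprS; ring.
Qed.

Lemma odd_prod_ge0 y s : 0 <= y -> 0 <= odd_prod y s.
Proof.
move=> y0; apply: prodr_ge0 => j _.
by rewrite addr_ge0// mulr_ge0// ltW ?odd_inv_gt0.
Qed.

Lemma norm_odd_prod_le y s : `|odd_prod y s| <= odd_prod `|y| s.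
Proof.
rewrite normr_prod; apply: ler_prod => j _; rewrite normr_ge0 /=.
rewrite (le_trans (ler_normD _ _))// normr1 lerD2l normrM.
by rewrite (gtr0_norm (odd_inv_gt0 _)).
Qed.

Lemma norm_t_summand x y s p :
  `|t_summand x y s p| = t_summand `|x| `|y| s p.
Proof.
have c0 : 0 <= odd_inv K s ^+ p.1.+2 * odd_esym K p.2 s.
  by rewrite mulr_ge0 ?odd_esym_ge0// exprn_ge0// ltW ?odd_inv_gt0.
by rewrite normrM (ger0_norm c0) normrM !normrX.
Qed.

Lemma odd_inv_mul_lt1 x s : `|x| < 1 -> odd_inv K s * `|x| < 1.
Proof.
move=> x1; apply: le_lt_trans x1.
by rewrite -[leRHS]mul1r ler_wpM2r// odd_inv_le1.
Qed.

Lemma odd_inv_den_neq0 x s : `|x| < 1 -> 1 - odd_inv K s * x != 0.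
Proof.
move=> /odd_inv_mul_lt1 => /(_ s) cx1; rewrite subr_eq0; apply/eqP => c1.
move: cx1; rewrite -{1}(gtr0_norm (odd_inv_gt0 s)) -normrM -c1.
by rewrite normr1 ltxx.
Qed.

Lemma sum_square (f : nat * nat -> K) N :
  \sum_(p <- square_fset N) f p = \sum_(m < N) \sum_(n < N) f (m : nat, n : nat).
Proof.
rewrite (perm_big [seq (m, n) | m <- iota 0 N, n <- iota 0 N]) /=; last first.
  apply: uniq_perm; rewrite ?sort_keys_uniq ?allpairs_uniq ?iota_uniq//.
    by move=> [? ?] [? ?] _ _.
  exact: sort_keysE.
have -> : iota 0 N = index_iota 0 N by rewrite /index_iota subn0.
by rewrite big_allpairs big_mkord; apply: eq_bigr => m _; rewrite big_mkord.
Qed.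

(** For [s < N] the sum over [n] is already complete, so only the tail of the geometric series in
    [m] is missing. *)
Lemma t_slice_remainder x y s N : `|x| < 1 -> (s < N)%N ->
  t_slice x y s - \sum_(p <- square_fset N) t_summand x y s p =
  (odd_inv K s * x) ^+ N * t_slice x y s.
Proof.
move=> x1 sN; have d0 := odd_inv_den_neq0 s x1.
have -> : \sum_(p <- square_fset N) t_summand x y s p =
    odd_inv K s ^+ 2 * odd_prod y s * \sum_(m < N) (odd_inv K s * x) ^+ m.
  rewrite sum_square mulr_sumr; apply: eq_bigr => m _ /=.
  rewrite -(sum_odd_esym y sN) mulr_sumr mulr_suml; apply: eq_bigr => n _.
  by rewrite /t_summand /= exprMn -addn2 exprD; ring.
have /esym := subrX1 (odd_inv K s * x) N.
rewrite -opprB mulNr => /eqP; rewrite eqr_oppLR opprB => /eqP sumE.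
move: sumE; move: (\sum_(i < N) _) => G sumE.
have -> : G = (1 - (odd_inv K s * x) ^+ N) / (1 - odd_inv K s * x).
  by rewrite -sumE mulrC mulKf.
by rewrite /t_slice; field.
Qed.

Lemma norm_t_slice_le x y s : `|x| < 1 ->
  `|t_slice x y s| <= t_slice `|x| `|y| s.
Proof.
move=> x1; rewrite /t_slice normrM normfV.
have c1 := odd_inv_mul_lt1 s x1.
have c0 : 0 <= odd_inv K s ^+ 2 by rewrite exprn_ge0// ltW ?odd_inv_gt0.
apply: ler_pM; rewrite ?invr_ge0 ?normr_ge0//.
  by rewrite normrM (ger0_norm c0) ler_wpM2l ?norm_odd_prod_le.
rewrite lef_pV2 ?posrE ?subr_gt0 ?normr_gt0 ?odd_inv_den_neq0//.
rewrite (le_trans _ (lerB_dist _ _))// normr1 normrM.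
by rewrite (gtr0_norm (odd_inv_gt0 _)).
Qed.

(** The right side is the mass of the norms outside [A]. No infinite sum is needed: [A] is enlarged
    to a square, where both remainders are explicit, and the triangle inequality handles the
    finitely many added pairs. *)
Lemma t_slice_dist_le x y s (A : {fset nat * nat}) : `|x| < 1 ->
  `|\sum_(p <- A) t_summand x y s p - t_slice x y s| <=
  t_slice `|x| `|y| s - \sum_(p <- A) t_summand `|x| `|y| s p.
Proof.
move=> x1; have [N /(_ (maxn N s.+1) (leq_maxl _ _))] := fset_sub_square A.
have : (s < maxn N s.+1)%N by rewrite leq_max leqnn orbT.
move: (maxn _ _) => {}N sN AN.
have nx1 : Num.norm (Num.norm x) < 1 by rewrite normr_id.
have := t_slice_remainder y x1 sN.
have := t_slice_remainder `|y| nx1 sN.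
rewrite !(big_fset_sub_split _ AN).
set S := \sum_(p <- A) _; set S' := \sum_(p <- A) _.
set Q := \sum_(p <- _ | _) _; set Q' := \sum_(p <- _ | _) _.
move=> /eqP; rewrite subr_eq => /eqP E /eqP; rewrite subr_eq => /eqP E'.
rewrite E E'.
have -> : S' - ((odd_inv K s * x) ^+ N * t_slice x y s + (S' + Q')) =
  - ((odd_inv K s * x) ^+ N * t_slice x y s) - Q' by ring.
have -> : (odd_inv K s * `|x|) ^+ N * t_slice `|x| `|y| s + (S + Q) - S =
  (odd_inv K s * `|x|) ^+ N * t_slice `|x| `|y| s + Q by ring.
rewrite (le_trans (ler_normB _ _))// normrN lerD//.
  rewrite normrM normrX normrM (gtr0_norm (odd_inv_gt0 _)).
  by rewrite ler_wpM2l ?norm_t_slice_le// exprn_ge0// mulr_ge0// ltW ?odd_inv_gt0.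
rewrite (le_trans (ler_norm_sum _ _ _))//.
by apply: ler_sum => p _; rewrite norm_t_summand.
Qed.

End NumField.

(** * Convergence and approximation for nonnegative real parameters *)

Section RealSeries.
Variable R : realType.
Implicit Types (a b : R).

Lemma t_summand_ge0 a b s p : 0 <= a -> 0 <= b -> 0 <= t_summand a b s p.
Proof.
move=> a0 b0; have c0 := ltW (odd_inv_gt0 R s).
apply: mulr_ge0; apply: mulr_ge0; rewrite ?odd_esym_ge0//; exact: exprn_ge0.
Qed.

Lemma t_slice_ge0 a b s : 0 <= a < 1 -> 0 <= b -> 0 <= t_slice a b s.
Proof.
move=> /andP[a0 a1] b0; have na : `|a| = a by rewrite ger0_norm.
have d0 : 0 < 1 - odd_inv R s * a by rewrite subr_gt0 -na odd_inv_mul_lt1 ?na.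
apply: divr_ge0 (ltW d0); apply: mulr_ge0; last exact: odd_prod_ge0.
by rewrite exprn_ge0// ltW ?odd_inv_gt0.
Qed.

(* With [q s := c_s * odd_prod b s] one has
   [q s - q s.+1 = q s * (2 - b) / (2 s + 3)], so the series telescopes. *)
Lemma sum_t_slice_le a b S : 0 <= a < 1 -> 0 <= b < 2 ->
  \sum_(s < S) t_slice a b s <=
  3 / ((1 - a) * (2 - b)) * (1 - odd_inv R S * odd_prod b S).
Proof.
move=> /andP[a0 a1] /andP[b0 b2]; elim: S => [|S IH].
  by rewrite big_ord0 /odd_prod big_ord0 /odd_inv invr1 mulr1 subrr mulr0.
rewrite big_ord_recr /=; apply: (le_trans (lerD IH (lexx _))).
rewrite /t_slice odd_prodS.
have := odd_prod_ge0 S b0; move: (odd_prod b S) => P P0.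
have E1 : (S.*2.+1)%:R = S%:R * 2 + 1 :> R by rewrite -natr1 -muln2 natrM.
have E3 : (S.+1.*2.+1)%:R = S%:R * 2 + 3 :> R.
  by rewrite doubleS -addn3 natrD -muln2 natrM.
rewrite -lerBrDl -mulrBr /odd_inv E1 E3.
move: (ler0n R S); move: S%:R => s s0 {IH E1 E3}.
have s1 : s * 2 + 1 != 0 by rewrite gt_eqF//; lra.
have s3 : s * 2 + 3 != 0 by rewrite gt_eqF//; lra.
have d : 0 < s * 2 + 1 - a by lra.
have -> : 3 / ((1 - a) * (2 - b)) *
    (1 - (s * 2 + 3)^-1 * (P * (1 + (s * 2 + 1)^-1 * b)) -
      (1 - (s * 2 + 1)^-1 * P)) =
   P / (s * 2 + 1) * (3 / ((1 - a) * (s * 2 + 3))).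
  by field; rewrite s1 s3 /= !subr_eq0 !gt_eqF.
have -> : (s * 2 + 1)^-1 ^+ 2 * P / (1 - (s * 2 + 1)^-1 * a) =
    P / (s * 2 + 1) * (s * 2 + 1 - a)^-1.
  by field; rewrite s1 !gt_eqF.
rewrite ler_wpM2l//; first by rewrite divr_ge0//; lra.
(* What remains is $(1-a)(2s+3) \le 3(2s+1-a)$; the difference of the two sides is $2s(2+a)$.
   Equality at $s = 0$ explains the constant 3. *)
rewrite ler_pdivlMr; last by rewrite mulr_gt0//; lra.
by rewrite mulrC ler_pdivrMr//; nra.
Qed.

Lemma is_cvg_series_t_slice a b : 0 <= a < 1 -> 0 <= b < 2 ->
  cvgn (series (t_slice a b)).
Proof.
move=> ha hb; have b0 : 0 <= b by case/andP: hb.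
apply: nondecreasing_is_cvgn.
  by apply: nondecreasing_series => n _ _; exact: t_slice_ge0.
exists (3 / ((1 - a) * (2 - b))) => _ [n _ <-].
rewrite /series /= big_mkord (le_trans (sum_t_slice_le n ha hb))//.
have ab : 0 <= 3 / ((1 - a) * (2 - b)).
  by case/andP: ha hb => ? ? /andP[? ?]; rewrite divr_ge0// mulr_ge0//; lra.
rewrite -[leRHS]mulr1 ler_wpM2l// gerBl mulr_ge0 ?odd_prod_ge0//.
by rewrite ltW ?odd_inv_gt0.
Qed.

(** Large squares suffice: their remainder carries the factor $(c_s a)^N$, which tends to 0. *)
Lemma t_slice_approx a b s e : 0 <= a < 1 -> 0 <= b -> 0 < e ->
  exists A : {fset nat * nat},
    t_slice a b s - \sum_(p <- A) t_summand a b s p < e.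
Proof.
move=> /andP[a0 a1] b0 e0.
have na : `|a| = a by rewrite ger0_norm.
have c1 : `|odd_inv R s * a| < 1.
  by rewrite normrM (gtr0_norm (odd_inv_gt0 _ _)) odd_inv_mul_lt1 ?na.
have : (odd_inv R s * a) ^+ n * t_slice a b s @[n --> \oo] --> 0 * t_slice a b s.
  by apply: cvgM; [exact: cvg_expr|exact: cvg_cst].
rewrite mul0r => /cvgrPdist_lt /(_ e e0) [N _ NP].
exists (square_fset (maxn N s.+1)).
rewrite t_slice_remainder ?na//; last by rewrite leq_max leqnn orbT.
have := NP (maxn N s.+1) (leq_maxl _ _).
by rewrite sub0r normrN; apply: le_lt_trans; exact: ler_norm.
Qed.

End RealSeries.

(** * Complex series with a real majorant, and the exchange of summations *)

Section ComplexSeries.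
Variable R : realType.
Local Notation C := R[i].

Lemma norm_real_complex (a : R) : `|a%:C%C| = `|a|%:C%C :> C.
Proof. by rewrite normc_def /= expr0n addr0 sqrtr_sqr. Qed.

Lemma cvg_real_complex (v : nat -> R) (l : R) : v @ \oo --> l ->
  (fun n => (v n)%:C%C : C^o) @ \oo --> (l%:C%C : C^o).
Proof.
move=> /cvgrPdist_lt vl; apply/cvgrPdist_lt => e e0.
(* A positive element of [R[i]] is real, so the estimate can be read in [R]. *)
have eE := RRe_real (gtr0_real e0).
have e'0 : 0 < complex.Re e by rewrite -ltcR eE.
apply: filterS (vl _ e'0) => n; rewrite -ltcR eE.
by rewrite -norm_real_complex rmorphB.
Qed.

(** Real and imaginary parts are bounded by the modulus, hence converge absolutely by comparison
    with [g], and are then recombined. *)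
Lemma is_cvg_series_complex (u : nat -> C^o) (g : nat -> R) :
  (forall n, `|u n| <= (g n)%:C%C) -> cvgn (series g) -> cvgn (series u).
Proof.
move=> ug cg.
have part (f : C -> R) : (forall z : C, `|f z|%:C%C <= `|z|) ->
    cvgn (series (f \o u)).
  move=> fz; apply: normed_cvg; apply: (series_le_cvg _ _ _ cg) => n /=.
  - exact: normr_ge0.
  - by rewrite -lecR (le_trans _ (ug n))// normr_ge0.
  - by rewrite -lecR (le_trans (fz _)).
have cRe := part (@complex.Re R) (@normc_ge_Re R).
have cIm : cvgn (series (@complex.Im R \o u)).
  (* The bound for the imaginary part follows from the one for the real part, as $\mathrm{Re}(iz) =
     -\mathrm{Im}\,z$ and $|iz| = |z|$. *)
  apply: part => z; rewrite -[leRHS]mul1r.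
  have -> : 1 = `|'i%C| :> C by rewrite normc_def /= expr0n expr1n add0r sqrtr1.
  rewrite -normrM -[complex.Im z]opprK normrN -complex.ReiNIm mulrC.
  exact: normc_ge_Re.
have -> : series u = (fun n => (series (@complex.Re R \o u) n)%:C%C +
    'i%C * (series (@complex.Im R \o u) n)%:C%C : C^o).
  apply/funext => n; rewrite /series /= !rmorph_sum mulr_sumr -big_split.
  by apply: eq_bigr => k _; exact: complexE.
apply: cvgP; apply: cvgD; first exact: cvg_real_complex cRe.
by apply: cvgM; [exact: cvg_cst|exact: cvg_real_complex cIm].
Qed.

(* A dominated exchange of summations: [dist_le] plays the role of the tail
   estimate [|F s - \sum_J T s| <= \sum_(p outside J) |T s p|]. *)
Section Exchange.
Variables (I : choiceType) (T : nat -> I -> C) (A : nat -> I -> R).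
Variables (F : nat -> C^o) (G : nat -> R) (u : I -> C^o).
Hypothesis dist_le : forall s (J : {fset I}),
  `|\sum_(p <- J) T s p - F s| <= (G s - \sum_(p <- J) A s p)%:C%C.
Hypothesis A_ge0 : forall s p, 0 <= A s p.
Hypothesis approx : forall s e, 0 < e ->
  exists J : {fset I}, G s - \sum_(p <- J) A s p < e.
Hypothesis cvgG : cvgn (series G).
Hypothesis cvgT : forall p, series (fun s => T s p : C^o) @ \oo --> u p.

Lemma exchange_slice_bound s : `|F s| <= (G s)%:C%C.
Proof. by have := dist_le s fset0; rewrite !big_seq_fset0 sub0r subr0 normrN. Qed.

Lemma exchange_slice_ge0 s : 0 <= G s.
Proof. by rewrite -lecR (le_trans _ (exchange_slice_bound s))// normr_ge0. Qed.

Lemma is_cvg_exchange : cvgn (series F).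
Proof. exact: is_cvg_series_complex exchange_slice_bound cvgG. Qed.

Lemma sum_fset_sub_le s (J J' : {fset I}) : (J `<=` J')%fset ->
  \sum_(p <- J) A s p <= \sum_(p <- J') A s p.
Proof.
by move=> JJ'; rewrite [leRHS](big_fset_sub_split _ JJ') lerDl sumr_ge0.
Qed.

(** One finite set serves the first [S] slices at once: take the union of the sets for the single
    slices; enlarging it only lowers the defects because [A] is nonnegative. *)
Lemma exchange_approx_sum S e : 0 < e ->
  exists J : {fset I}, forall J' : {fset I}, (J `<=` J')%fset ->
    \sum_(s < S) (G s - \sum_(p <- J') A s p) < e.
Proof.
elim: S e => [|S IH] e e0; first by exists fset0 => J' _; rewrite big_ord0.
have e20 : 0 < e / 2 by rewrite divr_gt0.
have [J JP] := IH _ e20; have [L LP] := approx S e20.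
exists (J `|` L)%fset => J'; rewrite fsubUset => /andP[/JP JJ' LJ'].
rewrite big_ord_recr /= [e]splitr ltrD//.
by apply: le_lt_trans LP; rewrite lerD2l lerN2 sum_fset_sub_le.
Qed.

(** The error at a finite set [L] is the sum over all [s] of the defects
    [F s - \sum_(p <- L) T s p]. It splits into three parts, each below [e / 3]: the passage to a
    partial sum, the slices before [S], which are small once [L] contains [J], and the later slices,
    dominated by the tail of [G]. *)
Lemma cvg_exchange :
  summability.partial_sum u @ summability.totally --> limn (series F).
Proof.
have Ft := @summability.totally_filter I.
apply/cvgrPdist_lt => e' e'0; have eE := RRe_real (gtr0_real e'0).
have {eE e'0} [e e0 ->] : exists2 e : R, 0 < e & e' = e%:C%C.
  by exists (complex.Re e'); rewrite // -ltcR eE.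
have e30 : 0 < e / 3 by rewrite divr_gt0.
have /cvgrPdist_lt /(_ _ e30) [S _ SP] : series G @ \oo --> limn (series G).
  exact: cvgG.
have [J JP] := exchange_approx_sum S e30.
exists J => // L /= JL.
have -> : summability.partial_sum u L = \sum_(p <- L) u p.
  by rewrite /summability.partial_sum big_seq_fsetE.
have cD : series (fun s => F s - \sum_(p <- L) T s p : C^o) @ \oo -->
    (limn (series F) - \sum_(p <- L) u p : C^o).
  have -> : series (fun s => F s - \sum_(p <- L) T s p : C^o) =
      (fun n => series F n - \sum_(p <- L) series (fun s => T s p : C^o) n).
    by apply/funext => n; rewrite /series /= exchange_big /= -sumrN -big_split.
  apply: cvgB; first exact: is_cvg_exchange.
  apply: cvg_big => [|p _]; [exact: add_continuous|exact: cvgT].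
have e3C : 0 < (e / 3)%:C%C :> C by rewrite ltcR.
have /cvgrPdist_lt /(_ _ e3C) [M _ MP] := cD.
(* The cut must lie beyond [M], to be close to the limit, and beyond [S], to be split there. *)
have := MP (maxn S M) (leq_maxr _ _).
have SM : (S <= maxn S M)%N := leq_maxl _ _.
move: (maxn S M) SM => N SN /= dN.
set l := limn _ - _ in dN *.
rewrite -[l](subrK (series (fun s => F s - \sum_(p <- L) T s p : C^o) N)).
apply: (le_lt_trans (ler_normD _ _)).
have -> : e = e / 3 + (e / 3 + e / 3) by field.
rewrite rmorphD /= ltrD//.
rewrite /series /= (le_lt_trans (ler_norm_sum _ _ _))//.
apply: (@le_lt_trans _ _ (\sum_(0 <= s < N) (G s - \sum_(p <- L) A s p))%:C%C).
  by rewrite rmorph_sum ler_sum// => s _; rewrite distrC dist_le.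
rewrite ltcR (big_cat_nat _ SN)//= ltrD//.
  by rewrite big_mkord JP.
apply: (@le_lt_trans _ _ (\sum_(S <= s < N) G s)).
  by apply: ler_sum => s _; rewrite gerBl sumr_ge0.
have nd : nondecreasing_seq (series G).
  by apply: nondecreasing_series => n _ _; exact: exchange_slice_ge0.
have := SP S (leqnn S); rewrite ger0_norm ?subr_ge0 ?nondecreasing_cvgn_le//.
apply: le_lt_trans; rewrite -(sub_series_geq _ SN) lerD2r.
exact: nondecreasing_cvgn_le.
Qed.

End Exchange.
End ComplexSeries.

(** * Multiple t-values as simple series over the largest index *)

Section Chains.
Variable R : realType.

(* The odd chains of length [k] with all entries smaller than [2 s + 1]. *)
Definition odd_chains_below (s k : nat) : set (seq nat) :=
  [set ns | odd_chains k.+1 (s.*2.+1 :: ns)].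

Definition chain_weight (s ns : seq nat) : R :=
  \prod_(ni <- zip ns s) ni.1%:R ^- ni.2.

Lemma chain_weight_ge0 s ns : 0 <= chain_weight s ns.
Proof. by apply: prodr_ge0 => i _; rewrite invr_ge0 exprn_ge0. Qed.

Lemma chain_weight_cons i s j ns :
  chain_weight (i :: s) (j.*2.+1 :: ns) = odd_inv R j ^+ i * chain_weight s ns.
Proof. by rewrite /chain_weight /= big_cons /odd_inv exprVn. Qed.

Lemma odd_chainsS k ns :
  odd_chains k.+1 ns <->
  exists j ms, odd_chains_below j k ms /\ ns = j.*2.+1 :: ms.
Proof.
split; last by move=> [j [ms [H ->]]].
case: ns => [[]//|n ns] H; have [_ _ /= /andP[on _]] := H.
have E : n = (n./2).*2.+1 by rewrite -[LHS]odd_double_half on.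
by exists n./2, ns; rewrite /odd_chains_below /= -E.
Qed.

Lemma odd_chains_belowS s k ns :
  odd_chains_below s k.+1 ns <->
  exists j ms, (j < s)%N /\ odd_chains_below j k ms /\ ns = j.*2.+1 :: ms.
Proof.
split.
  move=> [[sz] /= st /andP[_ od]].
  have : odd_chains k.+1 ns by split=> //; exact: path_sorted st.
  move=> /odd_chainsS[j [ms [H E]]]; exists j, ms; split=> //.
  by move: st; rewrite E /= => /andP[]; rewrite /gtn /= ltnS ltn_double.
move=> [j [ms [js [[sz st od] ->]]]]; split=> /=.
- by rewrite -sz.
- by apply/andP; split; [rewrite /gtn /= ltnS ltn_double|exact: st].
- by apply/andP; split; [rewrite /= odd_double|exact: od].
Qed.

(** Reindexing along the injection $(j, ms) \mapsto (2j+1) :: ms$. It is used with [J] all of [nat]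
    for the unrestricted chains, and with [J] the numbers below [s] in the induction on length. *)
Lemma esum_odd_chains_cons (J : set nat) (Q : set (seq nat)) k
    (f : seq nat -> \bar R) :
  (forall ns, 0 <= f ns)%E ->
  (forall ns, Q ns <-> exists j ms,
     J j /\ odd_chains_below j k ms /\ ns = j.*2.+1 :: ms) ->
  (\esum_(ns in Q) f ns =
   \esum_(j in J) \esum_(ms in odd_chains_below j k) f (j.*2.+1 :: ms))%E.
Proof.
move=> f0 QE; rewrite esum_esum//.
apply: (reindex_esum _ _ (fun p : nat * seq nat => p.1.*2.+1 :: p.2)).
split.
- by move=> [j ms] /= [Jj Hms]; apply/QE; exists j, ms.
- move=> [j ms] [j' ms'] _ _ /= [/double_inj -> ->//].
- by move=> ns /QE[j [ms [Jj [H ->]]]]; exists (j, ms).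
Qed.

(* The factor [c] makes the induction on [k] go through without having to
   scale an [esum]. *)
Lemma esum_chains_below c k s : 0 <= c ->
  (\esum_(ns in odd_chains_below s k) (c * chain_weight (nseq k 1%N) ns)%:E =
   (c * odd_esym R k s)%:E)%E.
Proof.
elim: k c s => [|k IH] c s c0.
  have -> : odd_chains_below s 0 = [set [::]].
    apply/seteqP; split=> [[|n ns] [] //|ns ->]; split=> //=.
    by rewrite odd_double.
  by rewrite esum_set1 /chain_weight ?big_nil ?mulr1// lee_fin.
rewrite (@esum_odd_chains_cons `I_s _ k); last 2 first.
- by move=> ns; rewrite lee_fin mulr_ge0 ?chain_weight_ge0.
- exact: odd_chains_belowS.
have cj j : 0 <= c * odd_inv R j by rewrite mulr_ge0// ltW ?odd_inv_gt0.
under eq_esum => j _.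
  under eq_esum => ms _ do rewrite chain_weight_cons expr1 mulrA.
  rewrite IH//; over.
rewrite esum_fset//; last first.
  by move=> j _; rewrite lee_fin mulr_ge0// odd_esym_ge0.
rewrite -fsbig_ord sumEFin /= mulr_sumr; congr EFin.
by apply: eq_bigr => j _; rewrite mulrA.
Qed.

(** $e_k$ is one of the nonnegative terms of the generating function at $y = 1$; the truncation is
    chosen beyond both [k] and [s]. *)
Lemma odd_esym_le_prod k s : odd_esym R k s <= odd_prod 1 s.
Proof.
have km : (k < (maxn k s).+1)%N by rewrite ltnS leq_maxl.
have sm : (s < (maxn k s).+1)%N by rewrite ltnS leq_maxr.
rewrite -(sum_odd_esym 1 sm) (bigD1 (Ordinal km)) //= expr1n mulr1 lerDl.
by apply: sumr_ge0 => i _; rewrite expr1n mulr1 odd_esym_ge0.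
Qed.

(** Comparison with [t_slice 0 1], whose terms are $c_s^2 \prod_{k<s}(1+c_k)$; the value $b = 1$
    lies in the range $b < 2$ of convergence. *)
Lemma is_cvg_series_t m n :
  cvgn (series (fun s => odd_inv R s ^+ m.+2 * odd_esym R n s)).
Proof.
have ge0 s : 0 <= odd_inv R s by rewrite ltW ?odd_inv_gt0.
apply: (series_le_cvg _ _ _ (@is_cvg_series_t_slice R 0 1 _ _)) => [s|s|s||].
- by apply: mulr_ge0; [exact: exprn_ge0|exact: odd_esym_ge0].
- by apply: t_slice_ge0; rewrite ?lexx ?ltr01.
- rewrite /t_slice mulr0 subr0 divr1; apply: ler_pM.
  + exact: exprn_ge0.
  + exact: odd_esym_ge0.
  + by apply: ler_wiXn2l => //; rewrite ?odd_inv_le1.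
  + exact: odd_esym_le_prod.
- by rewrite lexx ltr01.
- by rewrite ler01 ltr1n.
Qed.

Lemma multiple_t_cvg m n :
  series (fun s => odd_inv R s ^+ m.+2 * odd_esym R n s) @ \oo -->
  multiple_t R (m.+2 :: nseq n 1%N).
Proof.
suff -> : multiple_t R (m.+2 :: nseq n 1%N) =
    limn (series (fun s => odd_inv R s ^+ m.+2 * odd_esym R n s)).
  exact: is_cvg_series_t.
rewrite /multiple_t /= size_nseq.
have c0 j i : 0 <= odd_inv R j ^+ i by rewrite exprn_ge0// ltW ?odd_inv_gt0.
rewrite (@esum_odd_chains_cons [set: nat] _ n
  (fun ns => (chain_weight (m.+2 :: nseq n 1%N) ns)%:E)); last 2 first.
- by move=> ns; rewrite lee_fin chain_weight_ge0.
- move=> ns; rewrite odd_chainsS; split.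
    by move=> [j [ms H]]; exists j, ms.
  by move=> [j [ms [_ H]]]; exists j, ms.
under eq_esum => j _.
  under eq_esum => ms _ do rewrite chain_weight_cons.
  rewrite esum_chains_below//; over.
rewrite -nneseries_esumT; last first.
  by move=> j; rewrite lee_fin mulr_ge0 ?odd_esym_ge0.
(* Convergence makes the extended sum finite, so [fine] returns its true value and not the
   default. *)
rewrite -[RHS]/(fine (limn _)%:E) -EFin_lim; last exact: is_cvg_series_t.
congr (fine (limn _)); apply/funext => N.
by rewrite /series /= sumEFin.
Qed.

End Chains.

(** * Transport along field morphisms, for the embedding of [R] into [R[i]] *)

Section Morphism.
Variables (K L : numFieldType) (f : {rmorphism K -> L}).

Lemma rmorph_odd_inv j : f (odd_inv K j) = odd_inv L j.
Proof. by rewrite fmorphV rmorph_nat. Qed.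

Lemma rmorph_odd_esym k s : f (odd_esym K k s) = odd_esym L k s.
Proof.
elim: k s => [|k IH] s /=; first exact: rmorph1.
by rewrite rmorph_sum; apply: eq_bigr => j _; rewrite rmorphM rmorph_odd_inv IH.
Qed.

Lemma rmorph_odd_prod y s : f (odd_prod y s) = odd_prod (f y) s.
Proof.
rewrite rmorph_prod; apply: eq_bigr => j _.
by rewrite rmorphD rmorph1 rmorphM rmorph_odd_inv.
Qed.

Lemma rmorph_t_summand x y s p :
  f (t_summand x y s p) = t_summand (f x) (f y) s p.
Proof.
by rewrite rmorphM rmorphM rmorphM !rmorphXn rmorph_odd_inv rmorph_odd_esym.
Qed.

Lemma rmorph_t_slice x y s : f (t_slice x y s) = t_slice (f x) (f y) s.
Proof.
rewrite rmorphM fmorphV rmorphB rmorph1 !rmorphM rmorph_odd_inv.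
by rewrite rmorph_odd_prod.
Qed.

End Morphism.

(** * Identification of the hypergeometric terms with the slices *)

Section Hypergeometric.
Variable K : numFieldType.
Implicit Types (x y : K) (s : nat).

Lemma rising_factorialS (a : K) s :
  rising_factorial a s.+1 = rising_factorial a s * (a + s%:R).
Proof. by rewrite /rising_factorial big_ord_recr. Qed.

Lemma rising_factorial1 s : rising_factorial (1 : K) s = s`!%:R.
Proof.
elim: s => [|s IH]; first by rewrite /rising_factorial big_ord0.
by rewrite rising_factorialS IH nat1r factS mulnC natrM.
Qed.

Lemma oddr_neq0 s : s%:R * 2 + 1 != 0 :> K.
Proof. by rewrite -natrM natr1 pnatr_eq0. Qed.

Lemma odd_invE s : odd_inv K s = (s%:R * 2 + 1)^-1.
Proof. by rewrite /odd_inv -natr1 -muln2 natrM. Qed.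

(** Each factor is $\frac{2k+1}{2}(1 + c_k y)$, and $(1/2)_s = (3/2)_s/(2s+1)$. *)
Lemma rising_factorial_half y s :
  rising_factorial (1 / 2 + y / 2) s =
  rising_factorial (3 / 2) s * (odd_inv K s * odd_prod y s).
Proof.
elim: s => [|s IH].
  by rewrite /rising_factorial /odd_prod !big_ord0 /odd_inv invr1 !mulr1.
rewrite !rising_factorialS IH odd_prodS !odd_invE.
have := oddr_neq0 s.+1; have := oddr_neq0 s; rewrite -[s.+1%:R]natr1 => h1 h3.
by field; rewrite h1 h3.
Qed.

(** The quotient of the two rising factorials telescopes; cleared of denominators, the identity
    holds for every [x]. *)
Lemma rising_factorial_half_sub x s :
  rising_factorial (1 / 2 - x / 2) s * (s%:R * 2 + 1 - x) =
  rising_factorial (3 / 2 - x / 2) s * (1 - x).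
Proof.
elim: s => [|s IH]; first by rewrite /rising_factorial !big_ord0; ring.
rewrite !rising_factorialS -[s.+1%:R]natr1.
have -> : rising_factorial (1 / 2 - x / 2) s * (1 / 2 - x / 2 + s%:R) *
    ((s%:R + 1) * 2 + 1 - x) =
    rising_factorial (1 / 2 - x / 2) s * (s%:R * 2 + 1 - x) *
    (3 / 2 - x / 2 + s%:R) by field.
by rewrite IH; ring.
Qed.

Lemma oddr_sub_neq0 x s : `|x| < 1 -> s%:R * 2 + 1 - x != 0.
Proof.
move=> x1; have -> : s%:R * 2 + 1 - x = (s%:R * 2 + 1) * (1 - odd_inv K s * x).
  by rewrite odd_invE; field; exact: oddr_neq0.
by rewrite mulf_neq0 ?oddr_neq0 ?odd_inv_den_neq0.
Qed.

(** $(1)_s$ cancels $s!$ and $(3/2)_s$ cancels as well. One factor $c_s$ comes from $(1/2+y/2)_s$,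
    the other from $1/(2s+1-x) = c_s/(1-c_s x)$. *)
Lemma hyp3F2_term_t_slice x y s : `|x| < 1 ->
  hyp3F2_term (1 / 2 + y / 2) (1 / 2 - x / 2) 1 (3 / 2) (3 / 2 - x / 2) 1 s =
  (1 - x) * t_slice x y s.
Proof.
move=> x1; rewrite /hyp3F2_term expr1n rising_factorial1 rising_factorial_half.
have b1 : rising_factorial (3 / 2 : K) s != 0.
  apply/prodf_neq0 => k _.
  have -> : 3 / 2 + k%:R = (k.+1%:R * 2 + 1) / 2 :> K.
    by rewrite -[k.+1%:R]natr1; field.
  by rewrite mulf_neq0 ?oddr_neq0 ?invr_eq0 ?pnatr_eq0.
have b2 : rising_factorial (3 / 2 - x / 2) s != 0.
  apply/prodf_neq0 => k _.
  have -> : 3 / 2 - x / 2 + k%:R = (k.+1%:R * 2 + 1 - x) / 2.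
    by rewrite -[k.+1%:R]natr1; field.
  by rewrite mulf_neq0 ?oddr_sub_neq0 ?invr_eq0 ?pnatr_eq0.
have d := oddr_sub_neq0 s x1.
have fs : s`!%:R != 0 :> K by rewrite pnatr_eq0 -lt0n fact_gt0.
have -> : rising_factorial (1 / 2 - x / 2) s =
    rising_factorial (3 / 2 - x / 2) s * (1 - x) / (s%:R * 2 + 1 - x).
  by rewrite -rising_factorial_half_sub mulfK.
rewrite /t_slice odd_invE.
by field; rewrite oddr_neq0 d fs b2 b1.
Qed.

End Hypergeometric.

(** * From the slices to the generating function *)

Lemma t_gen_termE (R : realType) (x y : R[i]) (p : nat * nat) :
  t_gen_term x y p.1.+1 p.2.+1 =
  x * y * ((multiple_t R (p.1.+2 :: nseq p.2 1%N))%:C%C *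
           (x ^+ p.1 * y ^+ p.2)).
Proof. by rewrite /t_gen_term /= !exprS; ring. Qed.

Theorem theorem5p2 (R : realType) (x y : R[i])
    (hx : `|x| < 1) (hy : `|y| < 2) :
  cvgn (series (hyp3F2_term (1 / 2 + y / 2) (1 / 2 - x / 2) 1
                            (3 / 2) (3 / 2 - x / 2) 1)) /\
  double_sum_to (t_gen_term x y)
    (x * y / (1 - x) *
     hyp3F2 (1 / 2 + y / 2) (1 / 2 - x / 2) 1 (3 / 2) (3 / 2 - x / 2) 1).
Proof.
have [a xa] : exists a : R, `|x| = a%:C%C.
  by exists (complex.Re `|x|); rewrite RRe_real// normr_real.
have [b yb] : exists b : R, `|y| = b%:C%C.
  by exists (complex.Re `|y|); rewrite RRe_real// normr_real.
have ha : 0 <= a < 1 by rewrite -ler0c -ltcR -xa normr_ge0.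
have hb : 0 <= b < 2 by rewrite -ler0c -ltcR -yb rmorph_nat normr_ge0.
have [a0 _] := andP ha; have [b0 _] := andP hb.
have dist_le s (J : {fset nat * nat}) :
    `|\sum_(p <- J) t_summand x y s p - t_slice x y s| <=
    (t_slice a b s - \sum_(p <- J) t_summand a b s p)%:C%C.
  rewrite (le_trans (t_slice_dist_le y s J hx))// xa yb.
  rewrite rmorphB rmorph_sum rmorph_t_slice /=.
  by under [in leRHS]eq_bigr do rewrite rmorph_t_summand.
have A_ge0 s p : 0 <= t_summand a b s p by exact: t_summand_ge0.
have cG := is_cvg_series_t_slice ha hb.
(* The general term with the common factor $xy$ removed, which is restored at the end. *)
pose u (p : nat * nat) : R[i]^o :=
  (multiple_t R (p.1.+2 :: nseq p.2 1%N))%:C%C * (x ^+ p.1 * y ^+ p.2).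
have cT p : series (fun s => t_summand x y s p : R[i]^o) @ \oo --> u p.
  have -> : series (fun s => t_summand x y s p : R[i]^o) = (fun n =>
      (series (fun s => odd_inv R s ^+ p.1.+2 * odd_esym R p.2 s) n)%:C%C *
      (x ^+ p.1 * y ^+ p.2) : R[i]^o).
    apply/funext => n; rewrite /series /= rmorph_sum mulr_suml.
    apply: eq_bigr => s _; rewrite rmorphM rmorphXn rmorph_odd_inv.
    by rewrite rmorph_odd_esym.
  apply: cvgM; last exact: cvg_cst.
  exact: cvg_real_complex (@multiple_t_cvg R p.1 p.2).
have cF := is_cvg_exchange dist_le cG.
have FE : series (hyp3F2_term (1 / 2 + y / 2) (1 / 2 - x / 2) 1 (3 / 2)
    (3 / 2 - x / 2) 1) =
    (fun n => (1 - x) * series (t_slice x y : nat -> R[i]^o) n : R[i]^o).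
  apply/funext => n; rewrite /series /= mulr_sumr.
  by apply: eq_bigr => s _; exact: hyp3F2_term_t_slice.
have cH : series (hyp3F2_term (1 / 2 + y / 2) (1 / 2 - x / 2) 1 (3 / 2)
    (3 / 2 - x / 2) 1) @ \oo -->
    ((1 - x) * limn (series (t_slice x y : nat -> R[i]^o)) : R[i]^o).
  by rewrite FE; apply: cvgM; [exact: cvg_cst|exact: cF].
split; first exact: cvgP cH.
rewrite /hyp3F2 (cvg_lim (@norm_hausdorff _ R[i]^o) cH).
have x1 : 1 - x != 0.
  by have := odd_inv_den_neq0 0 hx; rewrite /odd_inv invr1 mul1r.
(* The factor $1-x$ by which hypergeometric terms exceed slices cancels the denominator of the
   prefactor. *)
have cancel (l : R[i]) : x * y / (1 - x) * ((1 - x) * l) = x * y * l by field.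
rewrite cancel /double_sum_to.
have -> : summability.partial_sum
    (fun p : nat * nat => t_gen_term x y p.1.+1 p.2.+1) =
    (fun J => x * y * summability.partial_sum u J : R[i]^o).
  apply/funext => J; rewrite /summability.partial_sum mulr_sumr.
  by apply: eq_bigr => p _; exact: t_gen_termE.
have Ft := @summability.totally_filter (nat * nat)%type.
apply: cvgM; first exact: cvg_cst.
apply: cvg_exchange dist_le A_ge0 _ cG cT => s e.
exact: t_slice_approx.
Qed.
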